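(* Let $\overrightarrow{\Gamma}=(I,\overrightarrow{E})$ be the directed graph associated to a graph $\Gamma=(I,E)$, let $\mathcal{A}_0=\{G_i,G_e,\psi_e\}$ be a fixed amalgam over $\overrightarrow{\Gamma}$, and let $(\mathcal{C}_0,\overrightarrow{\Gamma})=\{A_i,A_e,\alpha_e\}$ be the reference graph of groups of $\mathcal{A}_0$. For an amalgam $\mathcal{A}=\{G_i,G_e,\varphi_e\}$ of type $\mathcal{A}_0$ let $((\mathcal{C}_0,\overrightarrow{\Gamma}),\delta^{\mathcal{A}})$ be its associated pointing, given by $\delta^{\mathcal{A}}_e=\varphi_e^{-1}\circ\psi_e$ for each $e\in\overrightarrow{E}$. Then the correspondence $\mathcal{A}\leftrightarrow((\mathcal{C}_0,\overrightarrow{\Gamma}),\delta^{\mathcal{A}})$ yields a bijection between isomorphism classes of amalgams of type $\mathcal{A}_0$ and isomorphism classes of pointings of $\mathcal{C}_0$.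
   Context: **Directed graph.** $\Gamma=(I,E)$ is a graph with vertex set $I$ and edge set $E$; multiple edges and loops are permitted. The directed graph $\overrightarrow{\Gamma}=(I,\overrightarrow{E})$ has, for each edge of $E$, two directed edges $e$ and $\bar e$, opposite to each other ($\bar{\bar e}=e$). The starting vertex of $e$ is $d_0(e)$ and its end vertex is $d_1(e)$, so $d_0(e)=d_1(\bar e)$. **Amalgams.** An amalgam over $\overrightarrow{\Gamma}$ is a collection $\mathcal{A}=\{G_i,G_e,\varphi_e\mid i\in I,e\in\overrightarrow{E}\}$, where $G_i$ and $G_e=G_{\bar e}$ are groups and $\varphi_e\colon G_{d_0(e)}\to G_e$ is an injective homomorphism for each $e\in\overrightarrow{E}$ (so each undirected edge carries the two inclusion maps $\varphi_e$, $\varphi_{\bar e}$ into the same group). A homomorphism $\phi$ from $\{G^1_i,G^1_e,\varphi^1_e\}$ to $\{G^2_i,G^2_e,\varphi^2_e\}$ is a collection of group homomorphisms $\phi_i\colon G^1_i\to G^2_i$ ($i\in I$) and $\phi_e=\phi_{\bar e}\colon G_e^1\to G_e^2$ ($e\in\overrightarrow{E}$) with $\phi_e\circ\varphi_e^1=\varphi_e^2\circ\phi_{d_0(e)}$ for all $e\in\overrightarrow{E}$. It is an isomorphism if all $\phi_i,\phi_e$ are bijective and $\phi^{-1}$ is a homomorphism of amalgams. **Type.** Given $\mathcal{A}_0=\{G_i,G_e,\psi_e\}$, an amalgam of type $\mathcal{A}_0$ is an amalgam $\{G_i,G_e,\varphi_e\}$ over $\overrightarrow{\Gamma}$ with the same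 groups $G_i,G_e$, such that for every $e\in\overrightarrow{E}$ the maps $\varphi_e$ and $\psi_e$ have the same image in $G_e$ (but may be different maps). Here $\varphi_e^{-1}$ denotes the inverse of $\varphi_e$ viewed as an isomorphism from $G_{d_0(e)}$ onto its image. **Graphs of groups.** A graph of groups $(\mathcal{C},\overrightarrow{\Gamma})$, $\mathcal{C}=\{A_i,A_e,\alpha_e\}$, consists of groups $A_i$ ($i\in I$), groups $A_e=A_{\bar e}$ ($e\in\overrightarrow{E}$), and homomorphisms $\alpha_e\colon A_e\to A_{d_0(e)}$, not required to be injective. **Reference graph.** The reference graph $(\mathcal{C}_0,\overrightarrow{\Gamma})$ of $\mathcal{A}_0$ has $A_i=\mathrm{Aut}(G_i)$; $A_e$ is the group of automorphisms of $G_e$ that leave invariant each of the two subgroups $\psi_e(G_{d_0(e)})$ and $\psi_{\bar e}(G_{d_1(e)})$ of $G_e$; and $\alpha_e\colon A_e\to A_{d_0(e)}$ is $\alpha_e(a)=\psi_e^{-1}\circ a\circ\psi_e$. **Pointings.** A pointing of a graph of groups $\{A_i,A_e,\alpha_e\}$ is given by a collection $\delta=\{\delta_e\mid e\in\overrightarrow{E}\}$ of elements $\delta_e\in A_{d_0(e)}$ (together with the graph of groups obtained by replacing $\alpha_e$ by $x\mapsto\delta_e\alpha_e(x)\delta_e^{-1}$). Two pointings $\delta^{(1)},\delta^{(2)}$ of the same graph of groups are isomorphic if there are elements $a_i\in A_i$ ($i\in I$) and $a_e=a_{\bar e}\in A_e$ ($e\in\overrightarrow{E}$) such that $\delta_e^{(1)}\alpha_e(a_e)=a_{d_0(e)}\delta_e^{(2)}$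 for all $e\in\overrightarrow{E}$. **Correspondence.** To $\mathcal{A}=\{G_i,G_e,\varphi_e\}$ of type $\mathcal{A}_0$ one associates the pointing $\delta^{\mathcal{A}}_e=\varphi_e^{-1}\circ\psi_e$; conversely, to a pointing $\delta$ of $\mathcal{C}_0$ one associates the amalgam of type $\mathcal{A}_0$ with $\varphi_e=\psi_e\circ\delta_e^{-1}$. Composition is right to left. *)

(* Defs.v *)
From HB Require Import structures.
From mathcomp Require Import all_boot.
From mathcomp Require Import boolp classical_sets functions.

Set Implicit Arguments.
Unset Strict Implicit.
Unset Printing Implicit Defensive.

Local Open Scope group_scope.
Local Open Scope classical_set_scope.
Local Open Scope quotient_scope.

(* The directed graph associated to an undirected graph with loops and multiple
   edges. The directed edges form a family [dart] over the undirected ones: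
   each edge x carries exactly two directed edges, exchanged by [bar]. Data
   with "G_e = G_(bar e)" is thus simply indexed by the undirected edge. *)
Record digraph := Digraph {
  vertex : Type;
  edge : Type;
  dart : edge -> Type;
  bar : forall x, dart x -> dart x;
  d0 : forall x, dart x -> vertex;
  dart_inhabited : forall x, inhabited (dart x);
  barK : forall x, involutive (@bar x);
  bar_neq : forall x (e : dart x), bar e <> e;
  dartP : forall x (e f : dart x), f = e \/ f = bar e }.

(* The inverse of an injective f, as a map from the image of f to G. Outside
   the image its value is irrelevant. *)
Definition ginv (G H : groupType) (f : G -> H) : H -> G :=
  'pinv_(fun=> 1) [set: G] f.

Section GInv.
Variables (G H : groupType) (f : G -> H).

Lemma ginvK : injective f -> cancel f (ginv f).
Proof. by move=> fI x; rewrite /ginv pinvKV ?inE // => u v _ _; apply: fI. Qed.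

Lemma ginvKr y : range f y -> f (ginv f y) = y.
Proof. by move=> fy; rewrite /ginv pinvK ?inE. Qed.
End GInv.

Section GInvComp.
Variables (G H : groupType) (f h : {multiplicative G -> H}).
Hypotheses (fI : injective f) (hI : injective h) (fh : range f = range h).

Lemma ginv_compE x : f ((ginv f \o h) x) = h x.
Proof. by rewrite /= ginvKr // fh; exists x. Qed.

Lemma ginv_compM : {morph ginv f \o h : x y / x * y}.
Proof. by move=> x y; apply: fI; rewrite ginv_compE !gmulfM !ginv_compE. Qed.

Lemma ginv_comp_bij : bijective (ginv f \o h).
Proof.
exists (ginv h \o f) => x /=.
  by rewrite ginvKr ?ginvK // fh; exists x.
by rewrite ginvKr ?ginvK // -fh; exists x.
Qed.
End GInvComp.

Record aut (G : groupType) := Aut {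
  aut_fun :> G -> G;
  autM : {morph aut_fun : x y / x * y};
  aut_bij : bijective aut_fun }.

HB.instance Definition _ (G : groupType) (a : aut G) :=
  isMultiplicative.Build G G (aut_fun a) (autM a).

HB.instance Definition _ (G : groupType) := gen_eqMixin (aut G).
HB.instance Definition _ (G : groupType) := gen_choiceMixin (aut G).

(* The group law of Aut(G) is composition from right to left. *)
Section AutGroup.
Variable G : groupType.
Implicit Types a b : aut G.

Lemma aut_ext a b : a =1 b -> a = b.
Proof.
case: a b => [f fM fB] [g gM gB] /= /funext fg; subst g.
by rewrite (Prop_irrelevance fM gM) (Prop_irrelevance fB gB).
Qed.

Definition aut_one : aut G :=
  @Aut G idfun (fun _ _ => erefl) (Bijective (fun=> erefl) (fun=> erefl)).

Fact aut_mulM a b : {morph a \o b : x y / x * y}.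
Proof. by move=> x y /=; rewrite !autM. Qed.

Definition aut_mul a b : aut G :=
  Aut (aut_mulM a b) (bij_comp (aut_bij a) (aut_bij b)).

Lemma aut_ginvK a : cancel a (ginv a).
Proof. exact/ginvK/bij_inj/aut_bij. Qed.

Lemma aut_ginvKr a : cancel (ginv a) a.
Proof. by move=> y; apply: ginvKr; have [g _ ga] := aut_bij a; exists (g y). Qed.

Fact aut_invM a : {morph ginv a : x y / x * y}.
Proof.
move=> x y; apply: (bij_inj (aut_bij a)).
by rewrite autM !aut_ginvKr.
Qed.

Definition aut_inv a : aut G :=
  Aut (aut_invM a) (Bijective (aut_ginvKr a) (aut_ginvK a)).

Fact aut_mulA : associative aut_mul.
Proof. by move=> a b c; apply: aut_ext. Qed.
Fact aut_1mul : left_id aut_one aut_mul.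
Proof. by move=> a; apply: aut_ext. Qed.
Fact aut_mul1 : right_id aut_one aut_mul.
Proof. by move=> a; apply: aut_ext. Qed.
Fact aut_mulV : left_inverse aut_one aut_inv aut_mul.
Proof. by move=> a; apply: aut_ext => x /=; rewrite aut_ginvK. Qed.
Fact aut_Vmul : right_inverse aut_one aut_inv aut_mul.
Proof. by move=> a; apply: aut_ext => x /=; rewrite aut_ginvKr. Qed.

HB.instance Definition _ := isGroup.Build (aut G)
  aut_mulA aut_1mul aut_mul1 aut_mulV aut_Vmul.
End AutGroup.

Record amalgam (Gam : digraph) := Amalgam {
  vgrp : vertex Gam -> groupType;
  egrp : edge Gam -> groupType;
  vincl : forall (x : edge Gam) (e : dart x),
    {multiplicative vgrp (d0 e) -> egrp x};
  vincl_inj : forall (x : edge Gam) (e : dart x), injective (vincl e) }.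

Record amalgam_hom (Gam : digraph) (A B : amalgam Gam) := AmalgamHom {
  hom_v : forall i : vertex Gam, {multiplicative vgrp A i -> vgrp B i};
  hom_e : forall x : edge Gam, {multiplicative egrp A x -> egrp B x};
  hom_incl : forall (x : edge Gam) (e : dart x),
    hom_e x \o vincl A e = vincl B e \o hom_v (d0 e) }.

(* f is bijective in every component, with inverse a homomorphism g. *)
Definition is_amalgam_iso (Gam : digraph) (A B : amalgam Gam)
    (f : amalgam_hom A B) : Prop :=
  exists g : amalgam_hom B A,
    (forall i, cancel (hom_v f i) (hom_v g i) /\
               cancel (hom_v g i) (hom_v f i)) /\
    (forall x, cancel (hom_e f x) (hom_e g x) /\
               cancel (hom_e g x) (hom_e f x)).

Definition amalgam_isomorphic (Gam : digraph) (A B : amalgam Gam) : Prop :=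
  exists f : amalgam_hom A B, is_amalgam_iso f.

Record amalgam_of_type (Gam : digraph) (A0 : amalgam Gam) := AmalgamOfType {
  tincl : forall (x : edge Gam) (e : dart x),
    {multiplicative vgrp A0 (d0 e) -> egrp A0 x};
  tincl_inj : forall (x : edge Gam) (e : dart x), injective (tincl e);
  tincl_range : forall (x : edge Gam) (e : dart x),
    range (tincl e) = range (vincl A0 e) }.

Coercion amalgam_of_amalgam_of_type (Gam : digraph) (A0 : amalgam Gam)
    (A : amalgam_of_type A0) : amalgam Gam :=
  @Amalgam Gam (vgrp A0) (egrp A0) (tincl A) (@tincl_inj _ _ A).

Record graph_of_groups (Gam : digraph) := GraphOfGroups {
  gog_v : vertex Gam -> groupType;
  gog_e : edge Gam -> groupType;
  gog_map : forall (x : edge Gam) (e : dart x),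
    {multiplicative gog_e x -> gog_v (d0 e)} }.

Section ReferenceGraph.
Variables (Gam : digraph) (A0 : amalgam Gam).

(* Both e and bar e are quantified over: a stabilizes the images of the two
   vertex groups attached to the edge x. *)
Definition ref_stab (x : edge Gam) : pred (aut (egrp A0 x)) :=
  fun a => `[< forall e : dart x,
    a @` range (vincl A0 e) = range (vincl A0 e) >].

Fact ref_stab_group x : group_closed (@ref_stab x).
Proof.
split=> [|a b /asboolP aS /asboolP bS].
  by apply/asboolP=> e; rewrite image_id.
apply/asboolP => e; set R := range _.
have [aR bR] : a @` R = R /\ b @` R = R by split; [apply: aS|apply: bS].
have bVR : ginv b @` R = R.
  rewrite -{1}bR image_comp -[RHS]image_id; congr (_ @` _).
  by apply/funext => y /=; exact: aut_ginvK.
by rewrite -[RHS]aR -[in RHS]bVR [RHS]image_comp.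
Qed.

Definition ref_e (x : edge Gam) := {a : aut (egrp A0 x) | ref_stab a}.

HB.instance Definition _ x := SubType.on (ref_e x).
HB.instance Definition _ x := Choice.on (ref_e x).
HB.instance Definition _ x := SubChoice_isSubGroup.Build
  (aut (egrp A0 x)) (@ref_stab x) (ref_e x) (@ref_stab_group x).

Section RefMap.
Variables (x : edge Gam) (e : dart x) (a : ref_e x).

Fact ref_comp_inj : injective (val a \o vincl A0 e).
Proof.
move=> g h /(bij_inj (aut_bij _)); exact: vincl_inj.
Qed.

Fact ref_comp_range : range (vincl A0 e) = range (val a \o vincl A0 e).
Proof.
rewrite -[RHS](image_comp (vincl A0 e) (val a)).
have /asboolP aS : ref_stab (val a) := valP a.
by rewrite aS.
Qed.

Definition ref_map_fun : aut (vgrp A0 (d0 e)) :=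
  @Aut _ (ginv (vincl A0 e) \o (val a \o vincl A0 e))
    (ginv_compM (@vincl_inj _ _ _ e) ref_comp_range)
    (ginv_comp_bij (@vincl_inj _ _ _ e) ref_comp_inj ref_comp_range).
End RefMap.

Fact ref_mapM (x : edge Gam) (e : dart x) :
  {morph @ref_map_fun x e : a b / a * b}.
Proof.
move=> a b; apply: aut_ext => g; apply: (@vincl_inj _ A0 _ e).
have E c h : vincl A0 e (ref_map_fun e c h) = val c (vincl A0 e h).
  exact: (ginv_compE (ref_comp_range e c)).
by rewrite E valM [RHS]E /= E.
Qed.

HB.instance Definition _ (x : edge Gam) (e : dart x) :=
  isMultiplicative.Build (ref_e x) (aut (vgrp A0 (d0 e)))
    (@ref_map_fun x e) (@ref_mapM x e).

Definition reference_graph : graph_of_groups Gam :=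
  @GraphOfGroups Gam (fun i => aut (vgrp A0 i)) ref_e
    (fun x e => @ref_map_fun x e).
End ReferenceGraph.

(* The twisted graph of groups with structure maps
   a |-> delta_e alpha_e(a) delta_e^-1 is determined by delta and is not
   recorded. *)
Definition pointing (Gam : digraph) (C : graph_of_groups Gam) : Type :=
  forall (x : edge Gam) (e : dart x), gog_v C (d0 e).

Definition pointing_isomorphic (Gam : digraph) (C : graph_of_groups Gam)
    (delta1 delta2 : pointing C) : Prop :=
  exists (av : forall i : vertex Gam, gog_v C i)
         (ae : forall x : edge Gam, gog_e C x),
    forall (x : edge Gam) (e : dart x),
      delta1 x e * gog_map C e (ae x) = av (d0 e) * delta2 x e.

Section Correspondence.
Variables (Gam : digraph) (A0 : amalgam Gam).

Definition pointing_of_amalgam (A : amalgam_of_type A0) :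
    pointing (reference_graph A0) :=
  fun x e => @Aut _ (ginv (tincl A e) \o vincl A0 e)
    (ginv_compM (@tincl_inj _ _ A x e) (tincl_range A e))
    (ginv_comp_bij (@tincl_inj _ _ A x e) (@vincl_inj _ A0 x e)
       (tincl_range A e)).

Section AmalgamOfPointing.
Variable delta : pointing (reference_graph A0).

Definition pt_incl (x : edge Gam) (e : dart x) :
    {multiplicative vgrp A0 (d0 e) -> egrp A0 x} :=
  vincl A0 e \o aut_fun ((@delta x e)^-1)%g.

Fact pt_incl_inj (x : edge Gam) (e : dart x) : injective (pt_incl e).
Proof.
move=> g h /vincl_inj; exact/bij_inj/aut_bij.
Qed.

Fact pt_incl_range (x : edge Gam) (e : dart x) :
  range (pt_incl e) = range (vincl A0 e).
Proof.
apply/seteqP; split=> _ [g _ <-]; first by exists (aut_fun (@delta x e)^-1%g g).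
by exists (aut_fun (@delta x e) g) => //=; rewrite aut_ginvK.
Qed.

Definition amalgam_of_pointing : amalgam_of_type A0 :=
  AmalgamOfType pt_incl_inj pt_incl_range.
End AmalgamOfPointing.
End Correspondence.

Section Equivalences.
Variable Gam : digraph.
Implicit Types A B C : amalgam Gam.

Definition amalgam_hom_id A : amalgam_hom A A :=
  @AmalgamHom _ A A (fun i => idfun) (fun x => idfun) (fun x e => erefl).

Fact amalgam_hom_comp_incl A B C (f : amalgam_hom A B) (g : amalgam_hom B C)
    (x : edge Gam) (e : dart x) :
  (hom_e g x \o hom_e f x) \o vincl A e
  = vincl C e \o (hom_v g (d0 e) \o hom_v f (d0 e)).
Proof. by rewrite -compA hom_incl compA hom_incl. Qed.

Definition amalgam_hom_comp A B C (f : amalgam_hom A B)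
    (g : amalgam_hom B C) : amalgam_hom A C :=
  @AmalgamHom _ A C (fun i => hom_v g i \o hom_v f i)
    (fun x => hom_e g x \o hom_e f x) (@amalgam_hom_comp_incl A B C f g).

Lemma amalgam_isomorphic_refl A : amalgam_isomorphic A A.
Proof. by exists (amalgam_hom_id A), (amalgam_hom_id A). Qed.

Lemma amalgam_isomorphic_sym A B :
  amalgam_isomorphic A B -> amalgam_isomorphic B A.
Proof.
move=> [f [g [fgv fge]]]; exists g, f.
by split=> i; [have [] := fgv i|have [] := fge i].
Qed.

Lemma amalgam_isomorphic_trans B A C :
  amalgam_isomorphic A B -> amalgam_isomorphic B C -> amalgam_isomorphic A C.
Proof.
move=> [f [g [fgv fge]]] [h [k [hkv hke]]].
exists (amalgam_hom_comp f h), (amalgam_hom_comp k g).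
split=> i; [have [fg gf] := fgv i; have [hk kh] := hkv i
           |have [fg gf] := fge i; have [hk kh] := hke i].
  by split; apply: can_comp.
by split; apply: can_comp.
Qed.

Variable D : graph_of_groups Gam.
Implicit Types delta : pointing D.

Lemma gog_map1 (x : edge Gam) (e : dart x) : gog_map D e 1 = 1.
Proof. by apply: (mulgI (gog_map D e 1)); rewrite -gmulfM !mulg1. Qed.

Lemma pointing_isomorphic_refl delta : pointing_isomorphic delta delta.
Proof.
by exists (fun=> 1), (fun=> 1) => x e; rewrite gog_map1 mulg1 mul1g.
Qed.

Lemma pointing_isomorphic_sym delta1 delta2 :
  pointing_isomorphic delta1 delta2 -> pointing_isomorphic delta2 delta1.
Proof.
move=> [av [ae E]]; exists (fun i => (av i)^-1), (fun x => (ae x)^-1) => x e.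
apply: (mulgI (av (d0 e))); rewrite mulgA -E -mulgA -gmulfM mulgV gog_map1.
by rewrite mulg1 mulgA mulgV mul1g.
Qed.

Lemma pointing_isomorphic_trans delta2 delta1 delta3 :
  pointing_isomorphic delta1 delta2 -> pointing_isomorphic delta2 delta3 ->
  pointing_isomorphic delta1 delta3.
Proof.
move=> [av [ae E]] [bv [be F]].
exists (fun i => av i * bv i), (fun x => ae x * be x) => x e.
by rewrite gmulfM mulgA E -mulgA F mulgA.
Qed.
End Equivalences.

HB.instance Definition _ (Gam : digraph) (A0 : amalgam Gam) :=
  gen_eqMixin (amalgam_of_type A0).
HB.instance Definition _ (Gam : digraph) (A0 : amalgam Gam) :=
  gen_choiceMixin (amalgam_of_type A0).
HB.instance Definition _ (Gam : digraph) (C : graph_of_groups Gam) :=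
  gen_eqMixin (pointing C).
HB.instance Definition _ (Gam : digraph) (C : graph_of_groups Gam) :=
  gen_choiceMixin (pointing C).

Section Classes.
Variables (Gam : digraph) (A0 : amalgam Gam) (C : graph_of_groups Gam).

Definition amalgam_iso_rel : rel (amalgam_of_type A0) :=
  fun A B => `[< amalgam_isomorphic A B >].

Fact amalgam_iso_rel_refl : reflexive amalgam_iso_rel.
Proof. by move=> A; apply/asboolP; apply: amalgam_isomorphic_refl. Qed.
Fact amalgam_iso_rel_sym : symmetric amalgam_iso_rel.
Proof. by move=> A B; apply/asboolP/asboolP; apply: amalgam_isomorphic_sym. Qed.
Fact amalgam_iso_rel_trans : transitive amalgam_iso_rel.
Proof.
move=> B A D /asboolP AB /asboolP BD; apply/asboolP.
exact: amalgam_isomorphic_trans AB BD.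
Qed.

Canonical amalgam_iso_equiv :=
  EquivRel amalgam_iso_rel amalgam_iso_rel_refl amalgam_iso_rel_sym
    amalgam_iso_rel_trans.

Definition amalgam_class := {eq_quot amalgam_iso_rel}.

Definition pointing_iso_rel : rel (pointing C) :=
  fun delta1 delta2 => `[< pointing_isomorphic delta1 delta2 >].

Fact pointing_iso_rel_refl : reflexive pointing_iso_rel.
Proof. by move=> d; apply/asboolP; apply: pointing_isomorphic_refl. Qed.
Fact pointing_iso_rel_sym : symmetric pointing_iso_rel.
Proof.
by move=> d d'; apply/asboolP/asboolP; apply: pointing_isomorphic_sym.
Qed.
Fact pointing_iso_rel_trans : transitive pointing_iso_rel.
Proof.
move=> d d' d'' /asboolP dd' /asboolP dd''; apply/asboolP.
exact: pointing_isomorphic_trans dd' dd''.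
Qed.

Canonical pointing_iso_equiv :=
  EquivRel pointing_iso_rel pointing_iso_rel_refl pointing_iso_rel_sym
    pointing_iso_rel_trans.

Definition pointing_class := {eq_quot pointing_iso_rel}.
End Classes.

Definition class_of_amalgam (Gam : digraph) (A0 : amalgam Gam)
  (A : amalgam_of_type A0) : amalgam_class A0 := \pi_{eq_quot _} A.

Definition class_of_pointing (Gam : digraph) (C : graph_of_groups Gam)
  (delta : pointing C) : pointing_class C := \pi_{eq_quot _} delta.

(* Main.v *)
(** Write phi_e = psi_e delta_e^-1. Then f_e phi^A_e = phi^B_e f_i holds, with
    i = d_0(e), if and only if delta^B_e alpha_e(f_e) = f_i delta^A_e. So an
    isomorphism A -> B is the same as an isomorphism of pointings from delta^B
    to delta^A: its edge components automatically stabilize the images of the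
    vertex groups, since A and B have the same images as A0. *)

Require Import Defs.
From mathcomp Require Import all_boot.
From mathcomp Require Import boolp classical_sets functions.

Set Implicit Arguments.
Unset Strict Implicit.
Unset Printing Implicit Defensive.

Local Open Scope group_scope.

Section Pointing.
Variables (Gam : digraph) (A0 : amalgam Gam).
Implicit Types A B : amalgam_of_type A0.

Lemma tincl_pointing A (x : edge Gam) (e : dart x) g :
  tincl A e (pointing_of_amalgam A e g) = vincl A0 e g.
Proof. exact: (ginv_compE (tincl_range A e)). Qed.

Lemma vincl_ref_map (x : edge Gam) (e : dart x) (b : ref_e A0 x) g :
  vincl A0 e (ref_map_fun e b g) = val b (vincl A0 e g).
Proof. exact: (ginv_compE (ref_comp_range e b)). Qed.

(** Composing the pointing equation with [tincl B e], and using [tincl_pointing] and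
    [vincl_ref_map], gives the square precomposed with the pointing of [A]. Nothing is lost, since
    [tincl B e] is injective and that pointing is bijective. *)
Lemma tincl_squareP A B (x : edge Gam) (e : dart x)
    (a : aut (vgrp A0 (d0 e))) (b : ref_e A0 x) :
  val b \o tincl A e =1 tincl B e \o a <->
  pointing_of_amalgam B e * gog_map (reference_graph A0) e b
  = a * pointing_of_amalgam A e.
Proof.
set dA := pointing_of_amalgam A e; set dB := pointing_of_amalgam B e.
split=> [sq|eq_ab g].
  apply: aut_ext => g; apply: (@tincl_inj _ _ B _ e).
  transitivity (val b (vincl A0 e g)).
    by rewrite -vincl_ref_map -(tincl_pointing B).
  by rewrite -(tincl_pointing A); exact: sq.
rewrite -[g](aut_ginvKr dA) /= tincl_pointing -vincl_ref_map.
rewrite -(tincl_pointing B); congr (tincl B e _).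
exact: (congr1 (fun c : aut _ => c (ginv dA g)) eq_ab).
Qed.

(** As [a] is onto, the square makes [b] carry the image of [tincl A e] onto that of [tincl B e];
    the type condition identifies both with the image of [vincl A0 e]. *)
Lemma tincl_square_range A B (x : edge Gam) (e : dart x)
    (a : aut (vgrp A0 (d0 e))) (b : aut (egrp A0 x)) :
  b \o tincl A e =1 tincl B e \o a ->
  (b @` range (vincl A0 e) = range (vincl A0 e))%classic.
Proof.
move=> sq; rewrite -{1}(tincl_range A) -(tincl_range B).
apply/seteqP; split=> [_ [_ [g _ <-] <-]|_ [g _ <-]].
  by exists (a g) => //; exact/esym/sq.
exists (tincl A e (ginv a g)); first by exists (ginv a g).
by apply: etrans (sq _) _; rewrite /= aut_ginvKr.
Qed.

Lemma pointing_of_amalgam_iso A B : amalgam_isomorphic A B ->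
  pointing_isomorphic (pointing_of_amalgam B) (pointing_of_amalgam A).
Proof.
move=> [f [g [fgv fge]]].
pose av i : aut (vgrp A0 i) :=
  @Aut (vgrp A0 i) (hom_v f i) gmulfM (Bijective (fgv i).1 (fgv i).2).
pose ae x : aut (egrp A0 x) :=
  @Aut (egrp A0 x) (hom_e f x) gmulfM (Bijective (fge x).1 (fge x).2).
have sq x (e : dart x) : ae x \o tincl A e =1 tincl B e \o av (d0 e).
  by move=> y; exact: (congr1 (fun h => h y) (hom_incl f e)).
have aeP x : ref_stab (ae x).
  by apply/asboolP => e; exact: tincl_square_range (sq x e).
exists av, (fun x => exist _ (ae x) (aeP x)) => x e.
by apply/(tincl_squareP A B (av (d0 e))) => y; exact: sq.
Qed.

Lemma amalgam_iso_of_pointing A B :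
  pointing_isomorphic (pointing_of_amalgam B) (pointing_of_amalgam A) ->
  amalgam_isomorphic A B.
Proof.
move=> [av [ae E]].
have sq x (e : dart x) :
    val (ae x) \o tincl A e = tincl B e \o aut_fun (av (d0 e)).
  by apply/funext/tincl_squareP.
(* The inverse components must again form a homomorphism: write [y] as the image of its preimage
   under [av], apply [sq] and cancel [ae x]. *)
have sqV x (e : dart x) :
    ginv (val (ae x)) \o tincl B e = tincl A e \o ginv (aut_fun (av (d0 e))).
  apply/funext => y /=; rewrite -{1}[y](aut_ginvKr (av (d0 e))).
  rewrite -[tincl B e _](congr1 (fun h => h _) (sq x e)) /=.
  exact: aut_ginvK.
exists (@AmalgamHom _ A B (fun i => aut_fun (av i))
  (fun x => aut_fun (val (ae x))) sq).
exists (@AmalgamHom _ B A (fun i => aut_fun (av i)^-1)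
  (fun x => aut_fun (val (ae x))^-1) sqV).
by split=> i; split=> y /=; rewrite ?aut_ginvK ?aut_ginvKr.
Qed.

(** With phi = psi delta^-1, delta solves phi delta = psi, and injectivity of phi makes the solution
    unique. So this round trip is an equality, not merely an isomorphism. *)
Lemma amalgam_of_pointingK :
  cancel (@amalgam_of_pointing Gam A0) (@pointing_of_amalgam Gam A0).
Proof.
move=> delta; apply: functional_extensionality_dep => x.
apply: functional_extensionality_dep => e; apply: aut_ext => g.
apply: (@tincl_inj _ _ (amalgam_of_pointing delta) _ e).
by rewrite tincl_pointing /= aut_ginvK.
Qed.

End Pointing.

Theorem theorem1 (Gam : digraph) (A0 : amalgam Gam) :
  exists (F : amalgam_class A0 -> pointing_class (reference_graph A0))
         (G : pointing_class (reference_graph A0) -> amalgam_class A0),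
    [/\ cancel F G, cancel G F,
        (forall A : amalgam_of_type A0,
           F (class_of_amalgam A) = class_of_pointing (pointing_of_amalgam A))
      & (forall delta : pointing (reference_graph A0),
           G (class_of_pointing delta)
           = class_of_amalgam (amalgam_of_pointing delta))].
Proof.
have classP (A B : amalgam_of_type A0) :
    class_of_amalgam A = class_of_amalgam B <-> amalgam_isomorphic A B.
  by split=> [/eqquotP/asboolP|AB] //; apply/eqquotP/asboolP.
have ptP (d d' : pointing (reference_graph A0)) :
    class_of_pointing d = class_of_pointing d' <-> pointing_isomorphic d d'.
  by split=> [/eqquotP/asboolP|dd'] //; apply/eqquotP/asboolP.
(* Both maps are computed on chosen representatives; [FE] and [GE] show that the choice is
   immaterial. *)
pose F (c : amalgam_class A0) :=
  class_of_pointing (pointing_of_amalgam (repr c)).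
pose G (c : pointing_class (reference_graph A0)) :=
  class_of_amalgam (amalgam_of_pointing (repr c)).
have FE A : F (class_of_amalgam A) = class_of_pointing (pointing_of_amalgam A).
  apply/ptP/pointing_of_amalgam_iso/classP.
  by rewrite /class_of_amalgam reprK.
have GE d : G (class_of_pointing d) = class_of_amalgam (amalgam_of_pointing d).
  apply/classP/amalgam_iso_of_pointing; rewrite !amalgam_of_pointingK.
  by apply/ptP; rewrite /class_of_pointing reprK.
exists F, G; split=> // c.
  (* It suffices to compare the pointings of the two amalgams, and these coincide by
     [amalgam_of_pointingK]. *)
  rewrite GE -[RHS]reprK; apply/classP/amalgam_iso_of_pointing.
  by rewrite amalgam_of_pointingK; exact: pointing_isomorphic_refl.
by rewrite FE amalgam_of_pointingK /class_of_pointing reprK.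
Qed.
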